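(* Let $\epsilon>0$ be a small enough constant and let $\delta>0$ be such that $\delta\le \epsilon^4$. Let $G=(V,E)$ be an $(n,d,\lambda)$-graph with $\frac{\lambda}{d}\le \delta$. Let $p=\frac{1+\epsilon}{d}$. Form $G_p$ by retaining every edge of $G$ independently with probability $p$. Let $L_1$ be the largest connected component of $G_p$. Then there exists an absolute constant $C$ such that with high probability the diameter of $L_1$ is at most $$C\,\frac{\ln \left(\frac{1}{\epsilon}\right)\ln n}{\epsilon^2}.$$
   Context: An $(n,d,\lambda)$-graph is a $d$-regular graph on $n$ vertices whose adjacency matrix has eigenvalues $d=\lambda_1\ge\lambda_2\ge\dots\ge\lambda_n$ with $\lambda=\max\{|\lambda_2|,|\lambda_n|\}$. ''With high probability'' means with probability tending to $1$ as $n\to\infty$, where $\epsilon,\delta$ are fixed and $G=G_n$ ranges over any sequence of $(n,d,\lambda)$-graphs satisfying the hypotheses ($d,\lambda$ may depend on $n$). ''$\epsilon$ small enough constant'' means that there is an absolute constant $\epsilon_0>0$ such that the statement holds for every fixed $0<\epsilon\le\epsilon_0$; ''absolute constant'' means independent of $\epsilon,\delta,n,d,\lambda,G$. The diameter of $L_1$ is the maximum graph distance in $G_p$ between two vertices of $L_1$. $\ln$ is the natural logarithm. *)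

(* Defs.v *)
From HB Require Import structures.
From mathcomp Require Import all_boot all_order all_algebra.
From mathcomp Require Import all_classical all_reals all_analysis.

Set Implicit Arguments.
Unset Strict Implicit.
Unset Printing Implicit Defensive.

Import Order.TTheory GRing.Theory Num.Theory.

Local Open Scope ring_scope.

Record sgraph (T : finType) := SGraph {
  adj :> rel T;
  adj_sym : symmetric adj;
  adj_irr : irreflexive adj }.

Definition edges (T : finType) (G : sgraph T) : {set {set T}} :=
  [set f : {set T} | [exists x, exists y, G x y && (f == [set x; y])]].

Definition regular (T : finType) (G : sgraph T) (d : nat) : Prop :=
  forall x : T, #|[set y | G x y]| = d.

Definition adjmx (R : realType) (n : nat) (G : sgraph 'I_n) : 'M[R]_n :=
  \matrix_(i, j) (G i j)%:R.

(* [s] lists the eigenvalues of [A] with multiplicity, in non-increasing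
   order; comparing degrees, [size s = n]. *)
Definition spectrum (R : realType) (n : nat) (A : 'M[R]_n) (s : seq R) : Prop :=
  sorted >=%R s /\ char_poly A = \prod_(a <- s) ('X - a%:P).

(* Indices are shifted by one: [s`_0], [s`_1], [s`_n.-1] are the first, second
   and last eigenvalue. *)
Definition ndl_graph (R : realType) (n d : nat) (lambda : R)
    (G : sgraph 'I_n) : Prop :=
  regular G d /\
  exists s : seq R,
    [/\ spectrum (adjmx R G) s,
        s`_0 = d%:R &
        lambda = Num.max `|s`_1| `|s`_n.-1| ].

(* Bond percolation: the random graph is identified with its set [H] of
   retained edges; the edges being independent, [H] has as probability the
   product below. *)
Definition perc_weight (R : realType) (T : finType) (G : sgraph T) (p : R)
    (H : {set {set T}}) : R :=
  \prod_(f in edges G) (if f \in H then p else 1 - p).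

Definition perc_prob (R : realType) (T : finType) (G : sgraph T) (p : R)
    (event : pred {set {set T}}) : R :=
  \sum_(H in powerset (edges G) | event H) perc_weight G p H.

Definition rel_of (T : finType) (H : {set {set T}}) : rel T :=
  [rel x y | [set x; y] \in H].

Definition components (T : finType) (e : rel T) : {set {set T}} :=
  [set [set y | connect e x y] | x : T].

Definition largest_component (T : finType) (e : rel T) (L : {set T}) : bool :=
  (L \in components e) && [forall K in components e, (#|K| <= #|L|)%N].

Definition walk (T : finType) (e : rel T) (k : nat) (x y : T) : bool :=
  [exists s : k.-tuple T, path e x s && (last x s == y)].

(* Shortest walks have length less than [#|T|]; the junk value [#|T|] is taken
   exactly when [y] cannot be reached from [x]. *)
Definition dist (T : finType) (e : rel T) (x y : T) : nat :=
  \big[minn/#|T|]_(k < #|T| | walk e k x y) k.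

Definition diam (T : finType) (e : rel T) (L : {set T}) : nat :=
  \max_(x in L) \max_(y in L) dist e x y.

(* In case of ties, the bound is required of every largest component. *)
Definition largest_diam_le (R : realType) (T : finType) (b : R) :
    pred {set {set T}} :=
  fun H => [forall L, largest_component (rel_of H) L ==>
                      ((diam (rel_of H) L)%:R <= b)].

(* Main.v *)
Require Import Defs.
From HB Require Import structures.
From mathcomp Require Import all_boot all_order all_algebra.
From mathcomp Require Import all_classical all_reals all_analysis.
From mathcomp Require Import sesquilinear spectral complex.
From mathcomp Require Import fintype finset zify ring lra.

Set Implicit Arguments.
Unset Strict Implicit.
Unset Printing Implicit Defensive.

Import Order.TTheory GRing.Theory Num.Theory.
Import numFieldNormedType.Exports.

Local Open Scope ring_scope.

(** Write [H] for the percolated graph, [B_r(u)] for its balls, and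
    [g = eps / 8]. With high probability every pair of vertices in a common
    component of [H] is at distance [O (ln n / eps ^ 2)], whether or not the
    component is a largest one; since [ln (1 / eps) >= 1] this is more than
    enough. Two random facts and one deterministic argument are behind it.

    Growth. Except with tiny probability, no ball whose size [t] is between
    [96 ln n / eps ^ 2] and [eps n / 8] satisfies
    [|B_(r+1)(u)| <= (1 + g) |B_r(u)|]. The estimate is a change of measure,
    from density [p = (1 + eps) / d] to the critical density [q = 1 / d].
    Suppose [B_r(u) = A] and [B_(r+1)(u) = D]. All [H]-edges between [A] and
    the complement of [D] are missing, and a breadth-first tree with
    [|D| - 1] edges witnesses both balls: every subgraph of [H] that keeps
    this tree has the same balls. Thinning [H] to density [q] keeps the tree
    with probability [(q / p) ^ (|D| - 1)], whence ([prob_thinning],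
    [prob_gballs])
      [P_p (A, D) <= (p/q) ^ |D| ((1-p)/(1-q)) ^ e(A, ~D) P_q (A, D)].
    By the mixing lemma [e(A, ~D)] is at least [d t (1 - eps / 6)], and the
    prefactor is at most [exp (- eps ^ 2 t / 24)] ([growth_factor]). As the
    events [(A, D)] partition the [q]-probability space, this bounds the
    probability of slow growth, with no count of trees or of connected sets.

    Merging. Let [P] and [Q] be the outermost layers of two disjoint balls.
    The two balls do not depend on the edges of [G] between [P] and [Q], so
    conditionally on them those edges are all missing with probability
    [(1 - p) ^ e(P, Q)] ([prob_all_closed], [prob_gap]). When [P] and [Q]
    have size at least [eps ^ 2 n / 128], the mixing lemma makes [e(P, Q)] of
    order [d n], and this probability is exponentially small in [n]. Here the
    hypothesis [lambda / d <= eps ^ 4] enters: it is far below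
    [eps ^ 2 / 128].

    Conclusion. If none of these bad events happens for a radius below some
    [N = O (ln n / eps ^ 2)], a ball either stops growing within
    [O (ln n / eps ^ 2)] steps, and is then the whole component, or grows
    geometrically past [eps n / 8] and has a layer of size [eps ^ 2 n / 128]
    on the way ([stable_or_large_layer]). Two balls of the second kind meet
    or are joined by an edge ([diam_le]). A union bound over centres and
    radii ([failure_bound]) leaves a failure probability [O (1 / n)].

    The mixing lemma follows from the spectral theorem over the complex
    numbers. It is used with the arithmetic mean [(|A| + |B|) / 2] in place
    of the geometric mean of the two sizes. *)

(** * The expander mixing lemma *)

(** Ordered pairs are counted: an edge inside [A :&: B] counts twice. *)
Definition ecount (T : finType) (G : rel T) (A B : {set T}) : nat :=
  \sum_(x in A) \sum_(y in B) G x y.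

Lemma char_poly_conj (F : fieldType) (n : nat) (U D : 'M[F]_n) :
  U \in unitmx -> char_poly (invmx U *m D *m U) = char_poly D.
Proof.
move=> uU; rewrite /char_poly /char_poly_mx.
have -> : 'X%:M - map_mx polyC (invmx U *m D *m U) =
  map_mx polyC (invmx U) *m ('X%:M - map_mx polyC D) *m map_mx polyC U.
  rewrite mulmxBr mulmxBl !map_mxM /=; congr (_ - _).
  by rewrite mul_mx_scalar -scalemxAl -map_mxM mulVmx // map_mx1 scalemx1.
rewrite !det_mulmx mulrC mulrA -det_mulmx -map_mxM mulmxV // map_mx1 det1.
by rewrite mul1r.
Qed.

Lemma sorted_tail_bound (R : realDomainType) (s : seq R) (a : R) :
  sorted >=%R s -> a \in behead s -> `|a| <= Num.max `|s`_1| `|s`_(size s).-1|.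
Proof.
case: s => [|b s] //= srt /(nthP 0) [i ilt <-].
have tr : transitive (>=%R : rel R) by move=> x y z /= h1 h2; apply: le_trans h2 h1.
have s_sorted : sorted >=%R s by apply: path_sorted srt.
case: s ilt s_sorted {srt} => [|c s] // ilt ss.
have nthle : forall j k, (j <= k)%N -> (k < size (c :: s))%N -> (c :: s)`_k <= (c :: s)`_j.
  move=> j k jk kl.
  exact: (sorted_leq_nth tr (fun x => lexx x) 0 ss _ _ (leq_ltn_trans jk kl) kl jk).
have lo := nthle i (size s) (ltac:(by rewrite -ltnS)) (ltac:(by [])).
have hi := nthle 0%N i (leq0n i) ilt.
rewrite /= in lo hi *.
set x := nth _ _ i in lo hi *; set y := nth _ _ (size s) in lo *.
rewrite le_max; case: (lerP 0 x) => x0.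
  by rewrite (ger0_norm x0) (le_trans hi (ler_norm _)).
rewrite (ltr0_norm x0); apply/orP; right.
by rewrite -normrN (le_trans _ (ler_norm _)) // lerN2.
Qed.

Lemma spectral_diag_char_poly (C : numClosedFieldType) (n : nat) (M : 'M[C]_n) :
  M \is normalmx ->
  char_poly M = \prod_(i < n) ('X - (spectral_diag M 0 i)%:P).
Proof.
move=> /orthomx_spectralP {1}->.
rewrite char_poly_conj ?spectral_unit // char_poly_trig ?diag_mx_is_trig //.
by apply: eq_bigr => i _; rewrite mxE eqxx mulr1n.
Qed.

Lemma perm_split_image (I : finType) (T : eqType) (f : I -> T) (a : T) (s : seq T) :
  perm_eq (a :: s) [seq f i | i <- enum I] ->
  exists2 i0, f i0 = a & forall i, i != i0 -> f i \in s.
Proof.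
move=> P; have : a \in [seq f i | i <- enum I] by rewrite -(perm_mem P) mem_head.
case/mapP=> i0 _ ai0; exists i0 => // i ne.
have := perm_to_rem (mem_enum I i0); move=> Q.
have : perm_eq (a :: s) (a :: [seq f i | i <- rem i0 (enum I)]).
  by apply: (perm_trans P); rewrite ai0; exact: (perm_map f Q).
rewrite perm_cons => /perm_mem ->; apply: map_f.
by rewrite mem_rem_uniq ?enum_uniq // !inE ne mem_enum.
Qed.

Section Mixing.
Variable R : realType.
Local Notation C := R[i].
Local Open Scope complex_scope.

(** The unitary diagonalisation and the listed spectrum have the same
    characteristic polynomial, so they agree up to order. *)
Lemma ndl_spectral n d (lambda : R) (G : sgraph 'I_n.+1)
    (M := map_mx (real_complex R) (adjmx R G) : 'M[C]_n.+1) :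
  ndl_graph d lambda G ->
  M \is hermsymmx /\ exists i0, spectral_diag M 0 i0 = d%:R /\
    forall i, i != i0 -> `|spectral_diag M 0 i| <= lambda%:C.
Proof.
move=> [reg [s [[srt cp] s0 lamE]]].
have symM : M \is hermsymmx.
  apply: realsym_hermsym.
    apply/is_hermitianmxP; rewrite expr0 scale1r map_mx_id //.
    by apply/matrixP=> i j; rewrite !mxE adj_sym.
  apply/mxOverP => i j; rewrite !mxE.
  by apply/complex_realP; exists ((G i j)%:R).
split=> //.
have E : \prod_(x <- map (real_complex R) s) ('X - x%:P) =
   \prod_(x <- [seq spectral_diag M 0 i | i <- enum 'I_n.+1]) ('X - x%:P).
  rewrite big_map [RHS]big_map.
  rewrite (@big_enum _ _ _ 'I_n.+1 predT).
  rewrite /= -spectral_diag_char_poly ?hermitian_normalmx //.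
  rewrite /M -map_char_poly cp rmorph_prod /=; apply: eq_bigr => a _.
  by rewrite rmorphB /= map_polyX map_polyC.
have szs : size s = n.+1.
  have := size_char_poly (adjmx R G); rewrite cp size_prod_XsubC => -[].
  by [].
move/prod_XsubC_eq: E.
case: s srt cp s0 lamE szs => [|a s] // srt cp s0 lamE szs /=.
move=> /perm_split_image [i0 e0 H]; exists i0; split.
  by rewrite e0; rewrite /= in s0; rewrite s0 rmorph_nat.
move=> i /H /mapP [b bs ->].
have := @sorted_tail_bound _ (a :: s) b srt bs; rewrite szs -lamE.
by rewrite normc_def /= expr0n /= addr0 sqrtr_sqr lecR.
Qed.

Local Open Scope sesquilinear_scope.

(** In an orthonormal eigenbasis the coordinates of [o] vanish off [i0], so the
    [i0]-th term of the expansion of [x M y^*] is [d (x o^* ) (o y^* ) / (o o^* )];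
    the other terms carry eigenvalues of modulus at most [l], and
    [2 |a b| <= |a| ^ 2 + |b| ^ 2] bounds their sum. Everything is multiplied
    by [o o^*], so that [o] need not be normalised. *)
Lemma form_bound (K : numClosedFieldType) n (M : 'M[K]_n.+1) (d l : K) (i0 : 'I_n.+1)
    (x y o : 'rV[K]_n.+1) :
  M \is normalmx ->
  spectral_diag M 0 i0 = d ->
  (forall i, i != i0 -> `|spectral_diag M 0 i| <= l) -> l < d ->
  0 <= l -> o *m M = d *: o ->
  `| (o *m o ^t*) 0 0 * (x *m M *m y ^t*) 0 0 -
     d * ((x *m o ^t*) 0 0 * (o *m y ^t*) 0 0)| <=
  (o *m o ^t*) 0 0 * (l * (((x *m x ^t*) 0 0 + (y *m y ^t*) 0 0) / 2)).
Proof.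
move=> nM Di0 Dl ld l0 oM.
set U := spectralmx M; set D := spectral_diag M.
have uU : U \is unitarymx by exact: spectral_unitarymx.
have ME : M = U ^t* *m diag_mx D *m U.
  by rewrite -invmx_unitary //; exact/orthomx_spectralP.
pose h (z : 'rV[K]_n.+1) := z *m U ^t*.
have hE (z w : 'rV[K]_n.+1) : (z *m w ^t*) 0 0 = \sum_i h z 0 i * (h w 0 i)^*.
  have -> : z *m w ^t* = h z *m (h w) ^t*.
    by rewrite /h trmx_mul map_mxM trmxCK mulmxA mulmxKtV.
  by rewrite mxE; apply: eq_bigr => i _; rewrite !mxE.
have hM (z w : 'rV[K]_n.+1) :
    (z *m M *m w ^t*) 0 0 = \sum_i D 0 i * (h z 0 i * (h w 0 i)^*).
  have -> : z *m M *m w ^t* = h z *m diag_mx D *m (h w) ^t*.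
    by rewrite /h trmx_mul map_mxM trmxCK ME !mulmxA.
  rewrite mxE; apply: eq_bigr => i _.
  rewrite mul_mx_diag !mxE; ring.
have ho i : i != i0 -> h o 0 i = 0.
  move=> ni; have Eo : h o *m diag_mx D = d *: h o.
    rewrite scalemxAl -oM /h ME !mulmxA.
    by rewrite mulmxtVK.
  have E : h o 0 i * D 0 i = d * h o 0 i.
    by move/rowP/(_ i): Eo; rewrite mul_mx_diag mxE => ->; rewrite mxE.
  have : (D 0 i - d) * h o 0 i = 0 by rewrite mulrBl mulrC E subrr.
  move/eqP; rewrite mulf_eq0 => /orP [|/eqP //].
  rewrite subr_eq0 => /eqP Dd; have := Dl _ ni; rewrite -/D Dd.
  by rewrite ger0_norm ?(ltW (le_lt_trans l0 ld)) // (lt_geF ld).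
have oo z : (z *m o ^t*) 0 0 = h z 0 i0 * (h o 0 i0)^*.
  rewrite hE (bigD1 i0) //= big1 ?addr0 // => j nj.
  by rewrite (ho _ nj) conjC0 mulr0.
have oo' z : (o *m z ^t*) 0 0 = h o 0 i0 * (h z 0 i0)^*.
  rewrite hE (bigD1 i0) //= big1 ?addr0 // => j nj.
  by rewrite (ho _ nj) mul0r.
have -> : d * ((x *m o ^t*) 0 0 * (o *m y ^t*) 0 0) =
    (o *m o ^t*) 0 0 * (d * (h x 0 i0 * (h y 0 i0)^*)).
  rewrite !oo !oo'; ring.
rewrite -mulrBr normrM.
have oge : 0 <= (o *m o ^t*) 0 0 by rewrite oo mul_conjC_ge0.
rewrite (ger0_norm oge); apply: ler_wpM2l => //.
rewrite hM (bigD1 i0) //= -/D Di0 [X in `|X - _|]addrC addrK.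
apply: (le_trans (ler_norm_sum _ _ _)).
rewrite !hE -big_split /= mulr_suml mulr_sumr.
rewrite [leRHS](bigD1 i0) //=.
rewrite -[leLHS]add0r; apply: lerD.
  by rewrite mulr_ge0 // divr_ge0 // addr_ge0 // mul_conjC_ge0.
apply: ler_sum => i ni.
rewrite !normrM norm_conjC.
apply: ler_pM => //; rewrite ?mulr_ge0 //.
  exact: Dl.
rewrite -!normCK ler_pdivlMr // -subr_ge0.
have -> : `|h x 0 i| ^+ 2 + `|h y 0 i| ^+ 2 - `|h x 0 i| * `|h y 0 i| * 2 =
  (`|h x 0 i| - `|h y 0 i|) ^+ 2 by ring.
by rewrite real_exprn_even_ge0 // rpredB // normr_real.
Qed.

(** [form_bound] for the indicators of [A] and [B], with the constant vector as
    the eigenvector of eigenvalue [d]. *)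
Lemma expander_mixing n d (lambda : R) (G : sgraph 'I_n) (A B : {set 'I_n}) :
  ndl_graph d lambda G -> lambda < d%:R ->
  `| (ecount G A B)%:R - d%:R * #|A|%:R * #|B|%:R / n%:R | <=
     lambda * ((#|A|%:R + #|B|%:R) / 2).
Proof.
case: n G A B => [|n] G A B ndl ld.
  have -> : A = finset.set0 by apply/setP => -[].
  have -> : B = finset.set0 by apply/setP => -[].
  by rewrite /ecount finset.big_set0 cards0 !mulr0 !mul0r subrr normr0 addr0 mul0r mulr0.
have [hM [i0 [Di0 Dl]]] := ndl_spectral ndl.
set M := map_mx _ _ in hM Di0 Dl.
have l0 : 0 <= lambda by case: ndl => _ [s [_ _ ->]]; rewrite le_max normr_ge0.
pose ind (S : {set 'I_n.+1}) : 'rV[C]_n.+1 := \row_i (i \in S)%:R.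
have indE S T : (ind S *m (ind T) ^t*) 0 0 = #|S :&: T|%:R.
  rewrite mxE -sum1_card natr_sum [RHS]big_mkcond /=; apply: eq_bigr => i _.
  by rewrite !mxE conjC_nat inE; do 2!case: (_ \in _); rewrite ?mulr1 ?mulr0 ?mul0r.
have indM : (ind A *m M *m (ind B) ^t*) 0 0 = (ecount G A B)%:R.
  rewrite mxE /ecount exchange_big natr_sum [RHS]big_mkcond /=; apply: eq_bigr => j _.
  rewrite !mxE conjC_nat mulr_suml; case: (j \in B); last first.
    by apply: big1 => i _; rewrite mulr0.
  rewrite natr_sum [RHS]big_mkcond; apply: eq_bigr => i _.
  rewrite !mxE mulr1 rmorph_nat; case: (i \in A); by rewrite ?mul1r ?mul0r.
have oM : ind [set: _]%SET *m M = d%:R *: ind [set: _]%SET.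
  apply/rowP => j; rewrite !mxE inE mulr1 -(ndl.1 j) -sum1_card natr_sum.
  rewrite [RHS]big_mkcond; apply: eq_bigr => i _.
  by rewrite !mxE !inE mul1r rmorph_nat adj_sym; case: (G _ _).
have := @form_bound _ n M d%:R lambda%:C i0 (ind A) (ind B) (ind [set: _]%SET)
  (hermitian_normalmx hM) Di0 Dl.
rewrite -(rmorph_nat (real_complex R)) ltcR ler0c => /(_ ld l0).
rewrite rmorph_nat => /(_ oM).
rewrite !indE indM !finset.setIT !finset.setTI !finset.setIid cardsT card_ord.
rewrite -!(rmorph_nat (real_complex R)) -!rmorphM /= -rmorphB /= -rmorphD /=.
rewrite -(fmorphV (real_complex R)) -!rmorphM /=.
rewrite normc_def /= expr0n /= addr0 sqrtr_sqr lecR => H.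
have n0 : 0 < n.+1%:R :> R by rewrite ltr0n.
rewrite -(ler_pM2l n0); apply: le_trans H.
rewrite -[X in X * _ <= _](ger0_norm (ltW n0)) -normrM le_eqVlt; apply/orP; left.
by apply/eqP; congr (`| _ |); field; rewrite nat1r pnatr_eq0.
Qed.

End Mixing.

(** * Balls, walks and breadth-first trees *)

Lemma big_minn_le (I : eqType) (r : seq I) (P : pred I) (x : nat) (F : I -> nat) i :
  i \in r -> P i -> (\big[minn/x]_(j <- r | P j) F j <= F i)%N.
Proof.
move=> ir Pi; elim: r ir => // a r IH; rewrite inE big_cons => /orP [/eqP <-|/IH h].
  by rewrite Pi geq_minl.
by case: ifP => // _; rewrite geq_min h orbT.
Qed.

Section Ball.
Variable T : finType.
Implicit Types (H K : {set {set T}}) (S A B : {set T}) (u v x y : T).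

Definition nbhd H S : {set T} := [set y | [exists x in S, [set x; y] \in H]].

Definition gball H u r : {set T} := iter r (fun S => S :|: nbhd H S) [set u].

Lemma nbhdP H S y :
  reflect (exists2 x, x \in S & [set x; y] \in H) (y \in nbhd H S).
Proof. by rewrite inE; apply: exists_inP. Qed.

Lemma gballS H u r : gball H u r.+1 = gball H u r :|: nbhd H (gball H u r).
Proof. by []. Qed.

Lemma gball_subS H u r : gball H u r \subset gball H u r.+1.
Proof. exact: subsetUl. Qed.

Lemma sub_gball H u i j : (i <= j)%N -> gball H u i \subset gball H u j.
Proof.
move=> /subnK <-; elim: (j - i)%N => [|k IH]; first by [].
exact: subset_trans IH (gball_subS _ _ _).
Qed.

Lemma gball_stable H u i j : gball H u i.+1 = gball H u i -> (i <= j)%N ->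
  gball H u j = gball H u i.
Proof.
move=> st /subnK <-; elim: (j - i)%N => // k IH.
by rewrite addSn gballS IH -gballS st.
Qed.

Lemma nbhd_mono H K S : K \subset H -> nbhd K S \subset nbhd H S.
Proof.
move=> sKH; apply/subsetP => y /nbhdP [x xS xy]; apply/nbhdP; exists x => //.
exact: (subsetP sKH).
Qed.

(** Hang every vertex of a new layer from one neighbour in the previous ball.
    A subgraph of [H] that contains the resulting tree [F] reaches each vertex
    as early as [H] does, and no earlier. *)
Lemma bfs_tree H u r : exists2 F : {set {set T}},
  (F \subset H) && (#|F| < #|gball H u r|)%N &
  forall K, F \subset K -> K \subset H ->
    forall i, (i <= r)%N -> gball K u i = gball H u i.
Proof.
elim: r => [|r [F /andP [FH cF] HF]].
  exists set0; first by rewrite sub0set cards0 cards1.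
  by move=> K _ _ i; rewrite leqn0 => /eqP ->.
pose L := gball H u r.+1 :\: gball H u r.
have par w : w \in L -> exists2 x, x \in gball H u r & [set x; w] \in H.
  rewrite /L gballS !inE; case: (w \in _) => //= /exists_inP [x xb xw].
  by exists x.
pose pa w := odflt u [pick x in gball H u r | [set x; w] \in H].
have paP w : w \in L -> pa w \in gball H u r /\ [set pa w; w] \in H.
  move=> /par [x xb xw]; rewrite /pa; case: pickP => [z /andP [] //|/(_ x)].
  by rewrite xb xw.
exists (F :|: [set [set pa w; w] | w in L]).
  apply/andP; split.
    rewrite subUset FH; apply/subsetP => f /imsetP [w wL ->].
    by have [] := paP _ wL.
  have cL : (#|gball H u r| + #|L| = #|gball H u r.+1|)%N.
    by rewrite -(cardsID (gball H u r) (gball H u r.+1)) (setIidPr (gball_subS _ _ _)).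
  rewrite -cL; apply: (leq_ltn_trans (leq_card_setU _ _)).
  rewrite -addSn; apply: leq_add.
    by [].
  exact: leq_imset_card.
move=> K; rewrite subUset => /andP [FK LK] KH i.
rewrite leq_eqVlt ltnS => /orP [/eqP ->|/(HF K FK KH) //].
rewrite !gballS HF //; apply/eqP; rewrite eqEsubset setUS ?nbhd_mono //=.
apply/subsetP => w wb; case: (boolP (w \in gball H u r)) => wr; first by rewrite inE wr.
have wL : w \in L by rewrite inE wr.
rewrite inE; apply/orP; right; apply/nbhdP; exists (pa w); first by case: (paP _ wL).
by apply: (subsetP LK); apply: imset_f.
Qed.

(** The ball of radius [r.+1] is determined by the edges that touch the ball of
    radius [r]. *)
Lemma gball_ext H K u r :
  (forall x y, x \in gball H u r -> ([set x; y] \in H) = ([set x; y] \in K)) ->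
  forall i, (i <= r.+1)%N -> gball K u i = gball H u i.
Proof.
move=> HK; elim=> [//|i IH] ir; rewrite !gballS IH ?(ltnW ir) //; congr (_ :|: _).
apply/setP => y; apply/nbhdP/nbhdP => -[x xb xy]; exists x => //.
  by rewrite HK // (subsetP (sub_gball H u (ir : (i <= r)%N))).
by rewrite -HK // (subsetP (sub_gball H u (ir : (i <= r)%N))).
Qed.

Lemma gball_path H u r x : x \in gball H u r ->
  exists s : seq T, [/\ path (rel_of H) u s, last u s = x & (size s <= r)%N].
Proof.
elim: r x => [|r IH] x; first by rewrite /gball inE => /eqP ->; exists [::].
rewrite gballS inE => /orP [/IH [s [p l sz]]|/nbhdP [z /IH [s [p l sz]] zx]].
  by exists s; split => //; apply: leqW.
exists (rcons s x); split; last by rewrite size_rcons.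
  by rewrite rcons_path p l.
by rewrite last_rcons.
Qed.

Lemma path_gball H u s : path (rel_of H) u s -> last u s \in gball H u (size s).
Proof.
elim/last_ind: s => [_|s x IH]; first by rewrite inE.
rewrite rcons_path last_rcons size_rcons gballS inE => /andP [/IH h e].
by apply/orP; right; apply/nbhdP; exists (last u s).
Qed.

Lemma rel_of_sym H : symmetric (rel_of H).
Proof. by move=> x y; rewrite /rel_of /= setUC. Qed.

(** The bound holds for paths longer than [#|T|] as well, because the junk value
    of [dist] is [#|T|]. *)
Lemma dist_path H u s k : path (rel_of H) u s -> (size s <= k)%N ->
  (dist (rel_of H) u (last u s) <= k)%N.
Proof.
move=> p sz; apply: leq_trans sz; rewrite /dist.
have [lt|ge] := ltnP (size s) #|T|; last first.
  by apply: leq_trans ge; elim/big_ind: _ => [//|x y hx hy|i _]; [by rewrite geq_min hx|exact: ltnW].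
have w : walk (rel_of H) (Ordinal lt) u (last u s).
  by apply/existsP; exists (in_tuple s); rewrite p eqxx.
exact: (big_minn_le #|T| (fun k : 'I_#|T| => k : nat) (mem_index_enum _) w).
Qed.

Lemma gball_sym H u v r : v \in gball H u r -> u \in gball H v r.
Proof.
move=> /gball_path [s [p l sz]].
have := rev_path (rel_of H) u s; rewrite l => E.
have p' : path (rel_of H) v (rev (belast u s)).
  by rewrite E (eq_path (e' := rel_of H)) // => x y; rewrite -rel_of_sym.
have l' : last v (rev (belast u s)) = u.
  by case: s {E p p' sz} l => [|a s] /=; rewrite ?rev_cons ?last_rcons // => ->.
have := path_gball p'; rewrite l' size_rev size_belast => h.
exact: (subsetP (sub_gball _ _ sz)).
Qed.

Lemma dist_gball H u v k : v \in gball H u k -> (dist (rel_of H) u v <= k)%N.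
Proof. by move=> /gball_path [s [p <- sz]]; apply: dist_path. Qed.

Lemma gball_trans H u v w i j : v \in gball H u i -> w \in gball H v j ->
  w \in gball H u (i + j).
Proof.
move=> /gball_path [s [p l sz]] /gball_path [t [q m tz]].
have pq : path (rel_of H) u (s ++ t) by rewrite cat_path p l.
have := path_gball pq; rewrite last_cat l m size_cat => h.
by apply: (subsetP (sub_gball _ _ _)) h; apply: leq_add.
Qed.

Lemma connect_gball H u v r : gball H u r.+1 = gball H u r ->
  connect (rel_of H) u v -> v \in gball H u r.
Proof.
move=> st /connectP [s p ->]; have := path_gball p => h.
have [sr|/ltnW rs] := leqP (size s) r.
  exact: (subsetP (sub_gball _ _ sr)).
by rewrite (gball_stable st rs) in h.
Qed.

End Ball.

Arguments gball : simpl never.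

(** * Random subsets: thinning and closing edges *)

Section RandomSubset.
Variables (R : realType) (I : finType) (E : {set I}).
Implicit Types (H K F X : {set I}) (p q : R).

Definition subset_weight p H : R := \prod_(f in E) (if f \in H then p else 1 - p).
Definition subset_prob p (A : pred {set I}) : R :=
  \sum_(H in powerset E | A H) subset_weight p H.

Lemma sum_powerset_prod (F1 F0 : I -> R) :
  \sum_(H in powerset E) \prod_(f in E) (if f \in H then F1 f else F0 f) =
  \prod_(f in E) (F1 f + F0 f).
Proof.
have -> : \prod_(f in E) (F1 f + F0 f) =
    \prod_f ((if f \in E then F1 f else 0) + (if f \in E then F0 f else 1)).
  by rewrite big_mkcond; apply: eq_bigr => f _; case: ifP => // _; rewrite add0r.
rewrite bigA_distr [RHS](bigID [pred H | H \in powerset E]) /=.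
rewrite [X in _ = _ + X]big1 ?addr0 => [|H]; last first.
  rewrite powersetE => /subsetPn [f fH fE].
  by rewrite (bigD1 f) //= fH (negPf fE) mul0r.
apply: eq_bigr => H; rewrite powersetE => HE; rewrite big_mkcond.
apply: eq_bigr => f _; case: (boolP (f \in E)) => // fE.
by case: ifP => // fH; rewrite (subsetP HE) in fE.
Qed.

Lemma prod_if_const F (a : R) : F \subset E ->
  \prod_(f in E) (if f \in F then a else 1) = a ^+ #|F|.
Proof.
move=> FE; rewrite -big_mkcondr -prodr_const; apply: eq_bigl => f.
by rewrite /= andb_idl // => /(subsetP FE).
Qed.

Lemma subset_weight_ge0 p H : 0 <= p <= 1 -> 0 <= subset_weight p H.
Proof.
by move=> /andP [p0 p1]; apply: prodr_ge0 => f _; case: ifP => // _; rewrite subr_ge0.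
Qed.

Lemma subset_prob_total p : subset_prob p predT = 1.
Proof.
rewrite /subset_prob (eq_bigl (mem (powerset E))) => [|H]; last by rewrite /= andbT.
rewrite /subset_weight (sum_powerset_prod (fun=> p) (fun=> 1 - p)).
by rewrite big1 // => f _; rewrite addrC subrK.
Qed.

Lemma subset_prob_compl p (A : pred {set I}) :
  subset_prob p A = 1 - subset_prob p (predC A).
Proof.
rewrite -(subset_prob_total p) /subset_prob [X in _ = X - _](bigID A) /=.
rewrite [X in _ = X + _ - _](eq_bigl (fun H => (H \in powerset E) && A H)) => [|H]; last by rewrite /= andbT.
rewrite [X in _ = _ + X - _](eq_bigl (fun H => (H \in powerset E) && ~~ A H)) ?addrK // => H.
by rewrite /= andbT.
Qed.

Lemma subset_prob_ge0 p A : 0 <= p <= 1 -> 0 <= subset_prob p A.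
Proof. by move=> hp; apply: sumr_ge0 => H _; apply: subset_weight_ge0. Qed.

Lemma subset_prob_le1 p A : 0 <= p <= 1 -> subset_prob p A <= 1.
Proof.
by move=> hp; rewrite subset_prob_compl gerBl subset_prob_ge0.
Qed.

Lemma subset_prob_union p (J : finType) (A : pred {set I}) (B : J -> pred {set I}) :
  0 <= p <= 1 ->
  (forall H, H \subset E -> A H -> exists j, B j H) ->
  subset_prob p A <= \sum_j subset_prob p (B j).
Proof.
move=> hp AB; rewrite /subset_prob.
under [leRHS]eq_bigr => j _ do rewrite big_mkcondr.
rewrite exchange_big /= big_mkcondr /=; apply: ler_sum => H.
rewrite powersetE => HE; case: ifP => [AH|_]; last first.
  by apply: sumr_ge0 => j _; case: ifP => // _; apply: subset_weight_ge0.
have [j BH] := AB _ HE AH; rewrite (bigD1 j) //= BH lerDl.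
by apply: sumr_ge0 => k _; case: ifP => // _; apply: subset_weight_ge0.
Qed.

Lemma subset_prob_partition p (V : finType) (h : {set I} -> V) (A : pred {set I}) :
  subset_prob p A = \sum_v subset_prob p [pred H | A H && (h H == v)].
Proof.
rewrite /subset_prob (partition_big h xpredT) //=; apply: eq_bigr => v _.
by apply: eq_bigl => H; rewrite andbA.
Qed.

(** Double counting with a kernel [M]: in both uses [M H K] is the weight of a
    coupling of two random subsets. *)
Lemma kernel_transfer (A B : pred {set I}) (w1 w2 : {set I} -> R)
    (M : {set I} -> {set I} -> R) (a b : R) :
  0 <= a ->
  (forall H, H \subset E -> A H ->
     w1 H <= a * \sum_(K in powerset E | B K) M H K) ->
  (forall K, K \subset E -> B K ->
     \sum_(H in powerset E | A H) M H K <= b * w2 K) ->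
  \sum_(H in powerset E | A H) w1 H <=
    a * b * \sum_(K in powerset E | B K) w2 K.
Proof.
move=> a0 h1 h2.
apply: (@le_trans _ _ (a * \sum_(H in powerset E | A H) \sum_(K in powerset E | B K) M H K)).
  rewrite mulr_sumr; apply: ler_sum => H /andP []; rewrite powersetE; exact: h1.
rewrite -mulrA; apply: ler_wpM2l => //; rewrite exchange_big mulr_sumr /=.
by apply: ler_sum => K /andP []; rewrite powersetE; exact: h2.
Qed.

Lemma le_sum_support (A B : pred {set I}) (m : {set I} -> R) :
  (forall K, 0 <= m K) -> (forall K, K \subset E -> A K -> m K != 0 -> B K) ->
  \sum_(K in powerset E | A K) m K <= \sum_(K in powerset E | B K) m K.
Proof.
move=> m0 AB; rewrite big_mkcondr [leRHS]big_mkcondr; apply: ler_sum => K.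
rewrite powersetE => KE; case: (boolP (A K)) => [AK|_]; last by case: ifP.
case: (boolP (B K)) => // nB; have [->//|/(AB _ KE AK)] := eqVneq (m K) 0.
by rewrite (negPf nB).
Qed.

Lemma subset_prob_mono p (A B : pred {set I}) :
  0 <= p <= 1 -> (forall H, H \subset E -> A H -> B H) ->
  subset_prob p A <= subset_prob p B.
Proof.
move=> hp AB; apply: le_sum_support => [K|K KE AK _]; first exact: subset_weight_ge0.
exact: AB.
Qed.

(** Couple [H] of density [p] with [K] of density [q] by thinning: [k b c] is the
    joint law at one element of the events [f \in H] and [f \in K].
    Given [H] in [A], thinning keeps the witness [F] with probability
    [(q / p) ^+ #|F|], and then [K] is in [A]. Given [K] in [A], the elements
    of [X] are outside [K]; that they are also outside [H] has conditional
    probability [(1 - p) / (1 - q)] for each of them. *)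
Lemma prob_thinning p q (A : pred {set I}) X m :
  0 < q -> q <= p -> p <= 1 -> q < 1 -> X \subset E ->
  (forall H, H \subset E -> A H -> [disjoint H & X]) ->
  (forall H, H \subset E -> A H -> exists2 F : {set I}, (F \subset H) && (#|F| <= m)%N &
     forall K, F \subset K -> K \subset H -> A K) ->
  subset_prob p A <= (p / q) ^+ m * ((1 - p) / (1 - q)) ^+ #|X| * subset_prob q A.
Proof.
move=> q0 qp p1 q1 XE AX AF.
have hpq : 1 <= p / q by rewrite ler_pdivlMr // mul1r.
pose k (b c : bool) : R := if b then (if c then q else p - q) else (if c then 0 else 1 - p).
have k0 b c : 0 <= k b c.
  by case: b; case: c => //=; rewrite ?subr_ge0 // ltW.
pose M H K := \prod_(f in E) k (f \in H) (f \in K).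
have M0 H K : 0 <= M H K by apply: prodr_ge0.
have M_sub H K : K \subset E -> M H K != 0 -> K \subset H.
  move=> KE; apply: contraR => /subsetPn [f fK fH].
  by rewrite /M (bigD1 f) ?(subsetP KE) //= /k (negPf fH) fK mul0r.
apply: (kernel_transfer (M := M)); first by rewrite exprn_ge0 // (le_trans _ hpq).
- move=> H HE AH; have [F /andP [FH cF] FK] := AF _ HE AH.
  have -> : subset_weight p H = (p / q) ^+ #|F| * \sum_(K in powerset E | F \subset K) M H K.
    rewrite big_mkcondr /=.
    rewrite (eq_bigr (fun K => \prod_(f in E) (if f \in K then (if f \in H then q else 0)
       else (if f \in F then 0 else if f \in H then p - q else 1 - p)))); last first.
      move=> K; rewrite powersetE => KE; case: (boolP (F \subset K)) => [sFK|].
        apply: eq_bigr => f _; rewrite /k; case: (boolP (f \in K)) => fK; case: (f \in H) => //=.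
          by rewrite (contraNF (subsetP sFK _) fK).
        by rewrite (contraNF (subsetP sFK _) fK).
      move=> /subsetPn [f fF fK]; rewrite (bigD1 f) /= ?fF ?(negPf fK) ?mul0r //.
      by rewrite (subsetP HE) // (subsetP FH).
    rewrite sum_powerset_prod -(prod_if_const _ (subset_trans FH HE)) -big_split /=.
    apply: eq_bigr => f fE; case: (boolP (f \in F)) => fF.
      by rewrite (subsetP FH) // addr0 divfK // gt_eqF.
    by rewrite mul1r; case: ifP => _; rewrite ?add0r // addrC subrK.
  apply: ler_pM.
  + by rewrite exprn_ge0 // (le_trans _ hpq).
  + exact: sumr_ge0.
  + exact: ler_weXn2l.
  + apply: le_sum_support => // K KE sFK MK; apply: FK => //; exact: M_sub.
move=> K KE AK.
apply: (@le_trans _ _ (\sum_(H in powerset E | [disjoint H & X]) M H K)).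
  by apply: le_sum_support => // H HE AH _; apply: AX.
rewrite big_mkcondr /=.
rewrite (eq_bigr (fun H => \prod_(f in E) (if f \in H then
     (if f \in X then 0 else if f \in K then q else p - q)
     else (if f \in K then 0 else 1 - p)))); last first.
  move=> H; rewrite powersetE => HE; case: ifP => [dHX|/negbT].
    apply: eq_bigr => f _; rewrite /k; case: (boolP (f \in H)) => // fH.
    by rewrite (disjointFr dHX fH).
  rewrite -setI_eq0 => /set0Pn [f]; rewrite inE => /andP [fH fX].
  by rewrite (bigD1 f) ?(subsetP HE) //= fH fX mul0r.
rewrite sum_powerset_prod -(prod_if_const _ XE) -big_split /= le_eqVlt; apply/orP; left.
apply/eqP; apply: eq_bigr => f fE.
have [fX|fX] := boolP (f \in X); last by rewrite mul1r; case: ifP => _; rewrite ?addr0 // addrC addrA subrK.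
have -> : f \in K = false by apply: (disjointFl (AX _ KE AK)).
by rewrite add0r divfK // subr_eq0 gt_eqF.
Qed.

(** The event [A] does not look at [X], so it is independent of [X] being
    closed. The coupling resamples the elements of [X] and keeps the others. *)
Lemma prob_all_closed p (A : pred {set I}) X :
  0 <= p <= 1 -> X \subset E ->
  (forall H K, H :\: X = K :\: X -> A H -> A K) ->
  subset_prob p [pred H | A H && [disjoint H & X]] <=
    (1 - p) ^+ #|X| * subset_prob p A.
Proof.
move=> /andP [p0 p1] XE AX.
pose w (b : bool) : R := if b then p else 1 - p.
have w0 b : 0 <= w b by case: b; rewrite /w // subr_ge0.
pose k (x b c : bool) : R := if x then (if b then 0 else 1 - p) * w c
   else if b == c then w b else 0.
have k0 x b c : 0 <= k x b c.
  rewrite /k; case: x; last by case: ifP.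
  by rewrite mulr_ge0 //; case: b => //; rewrite subr_ge0.
pose M H K := \prod_(f in E) k (f \in X) (f \in H) (f \in K).
have M0 H K : 0 <= M H K by apply: prodr_ge0.
rewrite -[X in X * _]mul1r.
apply: (kernel_transfer (M := M)) => //.
- move=> H HE /andP [AH dHX]; rewrite mul1r.
  have -> : subset_weight p H = \sum_(K in powerset E | true) M H K.
    rewrite (eq_bigl (mem (powerset E))) => [|K]; last by rewrite /= andbT.
    rewrite (eq_bigr (fun K => \prod_(f in E) (if f \in K then k (f \in X) (f \in H) true
      else k (f \in X) (f \in H) false))); last first.
      by move=> K _; apply: eq_bigr => f _; case: (f \in K).
    rewrite sum_powerset_prod; apply: eq_bigr => f fE; rewrite /k /w.
    have [fX|fX] := boolP (f \in X).
      by rewrite (disjointFl dHX fX) /=; ring.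
    by case: (f \in H); rewrite /= ?add0r ?addr0.
  apply: le_sum_support => // K KE _ MK; apply: AX AH.
  apply/setP => f; rewrite !inE; have [//|fX /=] := boolP (f \in X).
  apply/eqP; apply: contraNT MK => ne.
  have fE : f \in E.
    apply: contraNT ne => fE.
    by rewrite (contraNF (subsetP HE _) fE) (contraNF (subsetP KE _) fE).
  by rewrite /M (bigD1 f) //= /k (negPf fX) (negPf ne) mul0r.
move=> K KE AK.
apply: (@le_trans _ _ (\sum_(H in powerset E | true) M H K)).
  exact: le_sum_support.
rewrite (eq_bigl (mem (powerset E))) => [|H]; last by rewrite /= andbT.
rewrite (eq_bigr (fun H => \prod_(f in E) (if f \in H then k (f \in X) true (f \in K)
      else k (f \in X) false (f \in K)))); last first.
  by move=> H _; apply: eq_bigr => f _; case: (f \in H).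
rewrite sum_powerset_prod -(prod_if_const _ XE) -big_split /= le_eqVlt; apply/orP; left.
apply/eqP; apply: eq_bigr => f fE; rewrite /k /w.
by case: (f \in X); case: (f \in K) => /=; ring.
Qed.

End RandomSubset.

(** * Balls in the percolated graph *)

Section Percolation.
Variables (R : realType) (T : finType) (G : sgraph T).
Implicit Types (H K : {set {set T}}) (A B D S : {set T}) (u v x y : T) (p q c : R).

Definition edge_cut A B : {set {set T}} :=
  [set [set z.1; z.2] | z in [set z in setX A B | G z.1 z.2]].

Lemma edge_cutP A B (f : {set T}) :
  reflect (exists x y, [/\ x \in A, y \in B, G x y & f = [set x; y]]) (f \in edge_cut A B).
Proof.
apply: (iffP imsetP) => [[[x y]]|[x [y [xA yB xy ->]]]].
  by rewrite !inE /= => /andP [/andP [xA yB] xy] ->; exists x, y.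
by exists (x, y); rewrite // !inE /= xA yB.
Qed.

Lemma edge_cut_sub A B : edge_cut A B \subset edges G.
Proof.
apply/subsetP => f /edge_cutP [x [y [_ _ xy ->]]]; rewrite inE.
by apply/existsP; exists x; apply/existsP; exists y; rewrite xy eqxx.
Qed.

Lemma pair_eq_disjoint A B x y x' y' : [disjoint A & B] ->
  x \in A -> x' \in A -> y \in B -> y' \in B ->
  [set x; y] = [set x'; y'] -> x = x' /\ y = y'.
Proof.
move=> dAB xA xA' yB yB' E.
have xB : x == y' = false by apply: contraTF yB' => /eqP <-; rewrite (disjointFr dAB xA).
have yA : y == x' = false by apply: contraTF yB => /eqP ->; rewrite (disjointFr dAB xA').
have : x \in [set x'; y'] by rewrite -E !inE eqxx.
have : y \in [set x'; y'] by rewrite -E !inE eqxx orbT.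
by rewrite !inE xB yA orbF /= => /eqP -> /eqP ->.
Qed.

Lemma card_edge_cut A B : [disjoint A & B] -> #|edge_cut A B| = ecount G A B.
Proof.
move=> dAB; rewrite card_in_imset.
  rewrite /ecount -sum1_card pair_big_dep /=.
  rewrite (eq_bigl (fun z => (z.1 \in A) && (z.2 \in B) && G z.1 z.2)); last first.
    by move=> z; rewrite !inE.
  by rewrite big_mkcondr /=; apply: eq_bigr => z _; case: (G _ _).
move=> [x y] [x' y']; rewrite !inE /= => /andP [/andP [xA yB] _] /andP [/andP [xA' yB'] _] E.
by have [-> ->] := pair_eq_disjoint dAB xA xA' yB yB' E.
Qed.

Definition gballs H u r := (gball H u r, gball H u r.+1).

(** [prob_thinning] for the event that the two balls are [AD.1] and [AD.2]; the
    witness is a breadth-first tree, and the closed elements are the edges that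
    leave [AD.2] from [AD.1]. *)
Lemma prob_gballs p q u r (AD : {set T} * {set T}) :
  0 < q -> q <= p -> p <= 1 -> q < 1 -> AD.1 \subset AD.2 ->
  subset_prob (edges G) p [pred H | gballs H u r == AD] <=
  (p / q) ^+ #|AD.2| * ((1 - p) / (1 - q)) ^+ ecount G AD.1 (~: AD.2) *
  subset_prob (edges G) q [pred H | gballs H u r == AD].
Proof.
case: AD => A D /= q0 qp p1 q1 AD.
have dAD : [disjoint A & ~: D] by rewrite -subsets_disjoint.
rewrite -card_edge_cut //; apply: prob_thinning => //; first exact: edge_cut_sub.
- move=> H HE; rewrite /= xpair_eqE => /andP [/eqP HA /eqP HD]; apply/pred0P => f /=; apply/negP => /andP [fH].
  move=> /edge_cutP [x [y [xA yD xy fE]]].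
  move: yD; rewrite inE -HD gballS HA !inE => /norP [_ /negP []].
  by apply/exists_inP; exists x; rewrite // -fE.
- move=> H HE; rewrite /= xpair_eqE => /andP [/eqP HA /eqP HD]; have [F /andP [FH cF] FK] := bfs_tree H u r.+1.
  exists F; first by rewrite FH /= -HD ltnW.
  by move=> K sFK KH; rewrite /= /gballs !(FK K) // HA HD.
Qed.

(** The bound of [prob_gballs] is summed over all bad pairs; what remains is [c]
    times a total probability at density [q]. *)
Lemma prob_gball_growth p q u r (bad : {set T} -> {set T} -> bool) c :
  0 < q -> q <= p -> p <= 1 -> q < 1 -> 0 <= c ->
  (forall A D, A \subset D -> bad A D ->
     (p / q) ^+ #|D| * ((1 - p) / (1 - q)) ^+ ecount G A (~: D) <= c) ->
  subset_prob (edges G) p [pred H | bad (gball H u r) (gball H u r.+1)] <= c.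
Proof.
move=> q0 qp p1 q1 c0 hc.
have hq : 0 <= q <= 1 by rewrite !ltW.
have hp : 0 <= p <= 1 by rewrite p1 (le_trans (ltW q0)).
rewrite (subset_prob_partition _ _ (fun H => gballs H u r)).
apply: (@le_trans _ _ (c * \sum_v subset_prob (edges G) q [pred H | predT H && (gballs H u r == v)])); last first.
  by rewrite -subset_prob_partition subset_prob_total mulr1.
rewrite mulr_sumr; apply: ler_sum => -[A D] _.
case: (boolP ((A \subset D) && bad A D)) => [/andP [AD bAD]|no].
  apply: (@le_trans _ _ (subset_prob (edges G) p [pred H | gballs H u r == (A, D)])).
    by apply: subset_prob_mono => // H _ /andP [].
  apply: le_trans (prob_gballs u r q0 qp p1 q1 (AD : (A, D).1 \subset (A, D).2)) _.
  by apply: ler_wpM2r; [exact: subset_prob_ge0|exact: hc].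
rewrite [leLHS]big_pred0 ?mulr_ge0 ?subset_prob_ge0 // => H /=.
apply/negP; rewrite xpair_eqE => /and3P [_ b /andP [/eqP HA /eqP HD]].
by move: no; rewrite -HA -HD b gball_subS.
Qed.

(** Conditionally on the four balls, the edges between the two outermost layers
    are fresh, because no such edge touches an inner ball. *)
Lemma prob_gap p u v r s (big : {set T} -> {set T} -> bool) c :
  0 <= p <= 1 -> 0 <= c ->
  (forall P Q : {set T}, [disjoint P & Q] -> big P Q -> (1 - p) ^+ ecount G P Q <= c) ->
  subset_prob (edges G) p [pred H |
    let P := gball H u r.+1 :\: gball H u r in
    let Q := gball H v s.+1 :\: gball H v s in
    [&& [disjoint gball H u r.+1 & gball H v s.+1], big P Q & [disjoint H & edge_cut P Q]]] <= c.
Proof.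
move=> hp c0 hc.
rewrite (subset_prob_partition _ _ (fun H => (gballs H u r, gballs H v s))).
rewrite -[leRHS]mulr1 -(subset_prob_total (edges G) p).
rewrite (subset_prob_partition _ _ (fun H => (gballs H u r, gballs H v s))).
rewrite mulr_sumr; apply: ler_sum => -[[A A'] [B B']] _.
pose P := A' :\: A; pose Q := B' :\: B.
case: (boolP ([&& A \subset A', B \subset B', [disjoint A' & B'] & big P Q])); last first.
  move=> no; rewrite [leLHS]big_pred0 ?mulr_ge0 ?subset_prob_ge0 // => H /=.
  rewrite !xpair_eqE; apply/negP => /and3P [_ /and3P [d b _]].
  move=> /andP [/andP [/eqP HA /eqP HA'] /andP [/eqP HB /eqP HB']].
  by move: no; rewrite /P /Q -HA -HA' -HB -HB' d b !gball_subS.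
move=> /and4P [AA BB dAB bPQ].
have dPQ : [disjoint P & Q].
  by apply: disjointWl (subsetDl _ _) (disjointWr (subsetDl _ _) dAB).
pose ev : pred {set {set T}} := [pred H | (gballs H u r, gballs H v s) == ((A, A'), (B, B'))].
apply: (@le_trans _ _ (subset_prob (edges G) p [pred H | ev H && [disjoint H & edge_cut P Q]])).
  apply: subset_prob_mono => // H _ /andP [/and3P [_ _ d] E].
  apply/andP; split=> //; move: E d; rewrite !xpair_eqE.
  by move=> /andP [/andP [/eqP -> /eqP ->] /andP [/eqP -> /eqP ->]].
apply: le_trans (prob_all_closed hp (edge_cut_sub _ _) _) _; last first.
  rewrite card_edge_cut //; apply: ler_pM; rewrite ?subset_prob_ge0 ?hc //.
    by rewrite exprn_ge0 // subr_ge0; case/andP: hp.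
move=> H K HK; rewrite /ev /= !xpair_eqE.
move=> /andP [/andP [/eqP HA /eqP HA'] /andP [/eqP HB /eqP HB']].
have HKE f : f \notin edge_cut P Q -> (f \in H) = (f \in K).
  by move=> fX; have := congr1 (fun Z : {set {set T}} => f \in Z) HK; rewrite !inE fX.
have nP x y : x \in A -> [set x; y] \notin edge_cut P Q.
  move=> xA; apply/negP => /edge_cutP [x' [y' [xP yQ _ E]]].
  have : x \in [set x'; y'] by rewrite -E !inE eqxx.
  rewrite !inE => /orP [] /eqP Ex.
    by move: xP; rewrite -Ex inE xA.
  by move: yQ; rewrite -Ex inE (disjointFr dAB) ?andbF // (subsetP AA).
have nQ x y : x \in B -> [set x; y] \notin edge_cut P Q.
  move=> xB; apply/negP => /edge_cutP [x' [y' [xP yQ _ E]]].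
  have : x \in [set x'; y'] by rewrite -E !inE eqxx.
  rewrite !inE => /orP [] /eqP Ex.
    by move: xP; rewrite -Ex inE (disjointFl dAB) ?andbF // (subsetP BB).
  by move: yQ; rewrite -Ex inE xB.
have eu i : (i <= r.+1)%N -> gball K u i = gball H u i.
  by apply: gball_ext => x y; rewrite HA => xA; apply: HKE; apply: nP.
have ev' i : (i <= s.+1)%N -> gball K v i = gball H v i.
  by apply: gball_ext => x y; rewrite HB => xB; apply: HKE; apply: nQ.
by rewrite !eu // !ev' // HA HA' HB HB' !eqxx.
Qed.

End Percolation.

(** * From growth and merging to the diameter *)

Section Deterministic.
Variables (R : realType) (T : finType).
Implicit Types (H : {set {set T}}) (u v x y : T).

Lemma card_gball_lt H u k : (forall i, (i < k)%N -> gball H u i.+1 != gball H u i) ->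
  (k < #|gball H u k|)%N.
Proof.
elim: k => [_|k IH ne]; first by rewrite /gball /= cards1.
apply: (@leq_ltn_trans #|gball H u k|); first by apply: IH => i ik; apply: ne; rewrite ltnW.
by apply: proper_card; rewrite properEneq eq_sym ne // gball_subS.
Qed.

Lemma card_layer H u r :
  #|gball H u r.+1 :\: gball H u r|%:R = #|gball H u r.+1|%:R - #|gball H u r|%:R :> R.
Proof.
rewrite cardsD (setIidPr (gball_subS _ _ _)) natrB //.
exact: subset_leq_card (gball_subS _ _ _).
Qed.

(** If the ball has not stopped by radius [T0], it has more than [T0] vertices
    from then on and growth applies: [L] more steps would fill [T] if they never
    passed [t1]. At the step that passes [t1], either the ball was below
    [t1 / 2], so the new layer is larger than [t1 / 2], or growth gives a layer
    of at least [g * t1 / 2]. *)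
Lemma stable_or_large_layer H u (T0 L : nat) (g t1 : R) :
  0 < g -> g <= 1 -> 1 <= t1 -> T0%:R <= t1 / 2 ->
  #|T|%:R < (1 + g) ^+ L ->
  (forall r, (r < T0 + L)%N -> (T0 <= #|gball H u r|)%N -> #|gball H u r|%:R <= t1 ->
     (1 + g) * #|gball H u r|%:R < #|gball H u r.+1|%:R) ->
  gball H u T0.+1 = gball H u T0 \/
  exists2 r, (r < T0 + L)%N & g * t1 / 2 <= #|gball H u r.+1 :\: gball H u r|%:R.
Proof.
move=> g0 g1 t11 T0t big grow.
case: (boolP [exists i : 'I_T0, gball H u i.+1 == gball H u i]) => [/existsP [i /eqP st]|].
  by left; rewrite !(gball_stable st) // ltnW // ltnS ltnW.
rewrite negb_exists => /forallP ns; right.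
have T0lt : (T0 < #|gball H u T0|)%N.
  by apply: card_gball_lt => i iT; apply: (ns (Ordinal iT)).
have cmono i j : (i <= j)%N -> (#|gball H u i| <= #|gball H u j|)%N.
  by move=> ij; apply: subset_leq_card; apply: sub_gball.
have ex : exists r, (r <= T0 + L)%N && (t1 < #|gball H u r|%:R).
  apply/not_existsP => no.
  have le r : (r <= T0 + L)%N -> #|gball H u r|%:R <= t1.
    by move=> rT; rewrite leNgt; apply/negP => h; apply: (no r); rewrite rT h.
  have step j : (j <= L)%N -> (1 + g) ^+ j <= #|gball H u (T0 + j)|%:R.
    elim: j => [_|j IH jL]; first by rewrite expr0 addn0 ler1n; apply: leq_ltn_trans T0lt.
    rewrite addnS; apply: ltW; apply: le_lt_trans (grow (T0 + j)%N _ _ _).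
    - by rewrite exprS; apply: ler_wpM2l; [lra|exact: IH (ltnW jL)].
    - by rewrite ltn_add2l.
    - exact: leq_trans (ltnW T0lt) (cmono _ _ (leq_addr _ _)).
    - by apply: le; rewrite leq_add2l ltnW.
  have := step L (leqnn L); rewrite leNgt => /negP; apply.
  by apply: le_lt_trans big; rewrite ler_nat max_card.
case: (ex_minnP ex) => -[|r] /andP [rT tr] rmin.
  by move: tr; rewrite /gball /= cards1; lra.
have rle : #|gball H u r|%:R <= t1.
  rewrite leNgt; apply/negP => h; have := rmin r; rewrite h (ltnW rT) ltnn.
  by move/(_ isT).
exists r => //; rewrite card_layer.
have [small|large] := lerP #|gball H u r|%:R (t1 / 2).
  have : g * t1 <= 1 * t1 by apply: ler_wpM2r; lra.
  lra.
have T0r : (T0 <= #|gball H u r|)%N by rewrite -(ler_nat R); lra.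
have := grow r rT T0r rle.
have : g * (t1 / 2) <= g * #|gball H u r|%:R by apply: ler_wpM2l; lra.
lra.
Qed.


(** The radii add up to at most [N + N], with one more step when the two balls
    are joined by an edge. *)
Lemma diam_le H (G : sgraph T) (big : pred {set T}) (T0 N : nat) K :
  (T0 <= N)%N ->
  (forall u, gball H u T0.+1 = gball H u T0 \/
    exists2 r, (r < N)%N & big (gball H u r.+1 :\: gball H u r)) ->
  (forall u v r s, (r < N)%N -> (s < N)%N ->
    let P := gball H u r.+1 :\: gball H u r in
    let Q := gball H v s.+1 :\: gball H v s in
    ~~ [&& [disjoint gball H u r.+1 & gball H v s.+1], big P && big Q
         & [disjoint H & edge_cut G P Q]]) ->
  K \in components (rel_of H) ->
  (diam (rel_of H) K <= (N + N).+1)%N.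
Proof.
move=> TN alt nogap /imsetP [z _ ->].
apply/bigmax_leqP => u; rewrite inE => zu; apply/bigmax_leqP => v; rewrite inE => zv.
have csym := sym_connect_sym (@rel_of_sym T H).
have uv : connect (rel_of H) u v by apply: connect_trans zv; rewrite csym.
apply: dist_gball.
have T0N : (T0 <= (N + N).+1)%N by rewrite leqW // (leq_trans TN) // leq_addr.
case: (alt u) => [st|[r rN bP]].
  by apply: (subsetP (sub_gball H u T0N)); apply: connect_gball.
case: (alt v) => [st|[s sN bQ]].
  apply: (subsetP (sub_gball H u T0N)); apply: gball_sym; apply: connect_gball st _.
  by rewrite csym.
have := nogap u v r s rN sN; rewrite /= bP bQ /= negb_and => /orP [].
  rewrite -setI_eq0 => /set0Pn [x]; rewrite inE => /andP [xu xv].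
  have le_rs : (r.+1 + s.+1 <= (N + N).+1)%N by rewrite leqW // leq_add.
  exact: (subsetP (sub_gball H u le_rs) _ (gball_trans xu (gball_sym xv))).
rewrite -setI_eq0 => /set0Pn [f]; rewrite inE => /andP [fH /edge_cutP [a [b [aP bQ' _ fE]]]].
have au : a \in gball H u r.+1 by apply: (subsetP (subsetDl _ _)) aP.
have bv : b \in gball H v s.+1 by apply: (subsetP (subsetDl _ _)) bQ'.
have bu : b \in gball H u r.+2.
  by rewrite gballS inE; apply/orP; right; apply/nbhdP; exists a; rewrite // -fE.
have le_rs : (r.+2 + s.+1 <= (N + N).+1)%N by rewrite addSn ltnS leq_add.
exact: (subsetP (sub_gball H u le_rs) _ (gball_trans bu (gball_sym bv))).
Qed.

End Deterministic.

(** * Elementary exponential estimates *)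

Section Numeric.
Variable R : realType.
Implicit Types x e a : R.

(** The second-order gain [ln (1 + e) <= e - e ^+ 2 / 3] is what beats the
    first-order cancellation in [growth_factor]. It comes from
    [expR x = expR (x / 4) ^+ 4 >= (1 + x / 4) ^+ 4]. *)
Lemma ler1D_expR_third e : 0 <= e -> e <= 1 / 10 -> 1 + e <= expR (e - e ^+ 2 / 3).
Proof.
move=> e0 e1; set x := e - e ^+ 2 / 3.
have xe : e * (29 / 30) <= x by rewrite /x; nra.
have x0 : 0 <= x by lra.
have h : 1 + x + 3 / 8 * x ^+ 2 <= expR x.
  have -> : expR x = expR (x / 4) ^+ 4 by rewrite -expRM_natr; congr expR; field.
  apply: (@le_trans _ _ ((1 + x / 4) ^+ 4)).
    have -> : (1 + x / 4) ^+ 4 = 1 + x + 3 / 8 * x ^+ 2 + x ^+ 3 / 16 + x ^+ 4 / 256.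
      by field.
    have := exprn_ge0 3 x0; have := exprn_ge0 4 x0; lra.
  rewrite lerXn2r ?nnegrE ?expR_ge0 ?expR_ge1Dx //; lra.
apply: le_trans h.
have : (e * (29 / 30)) ^+ 2 <= x ^+ 2 by rewrite lerXn2r ?nnegrE; lra.
rewrite /x; nra.
Qed.

Lemma expR_half_le x : 0 <= x -> x <= 1 -> expR (x / 2) <= 1 + x.
Proof.
move=> x0 x1.
have h := expR_ge1Dx (- (x / 2)).
have pos := expR_gt0 (x / 2).
have : expR (x / 2) * (1 - x / 2) <= 1.
  by rewrite -[leRHS](expRxMexpNx_1 (x / 2)); apply: ler_wpM2l; [exact: ltW|lra].
nra.
Qed.

Lemma expRN_le_pow5 x : 0 < x -> expR (- x) <= 120 / x ^+ 5.
Proof.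
move=> x0; have := expR_ge1Dxn 4 (ltW x0).
have -> : 5`!%:R = 120 :> R by [].
move=> h; rewrite expRN ler_pdivlMr ?exprn_gt0 //.
have := expR_gt0 x => pos.
rewrite mulrC ler_pdivrMr //; lra.
Qed.

Lemma expR1_le4 : expR 1 <= 4 :> R.
Proof.
have h : expR (1 / 2) <= 2 :> R.
  by have := @expR_half_le 1 ler01 (lexx _); lra.
have -> : 1 = 1 / 2 + 1 / 2 :> R by lra.
rewrite expRD; have := expR_gt0 (1 / 2 : R); nra.
Qed.

Lemma ln_ge1 x : 4 <= x -> 1 <= ln x.
Proof.
move=> x4; rewrite -[1]expRK ler_ln ?posrE ?expR_gt0 //; last lra.
exact: le_trans expR1_le4 x4.
Qed.

Lemma ln_sqr_le x : 1 <= x -> ln x ^+ 2 <= 2 * x.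
Proof.
move=> x1; have l0 : 0 <= ln x by apply: ln_ge0.
have := expR_ge1Dxn 1 l0; rewrite lnK ?posrE; last lra.
have -> : 2`!%:R = 2 :> R by [].
lra.
Qed.

End Numeric.

(** * The failure probability on an expander *)

Section Expander.
Variables (R : realType) (n d : nat) (lambda eps : R) (G : sgraph 'I_n).
Hypotheses (ndl : ndl_graph d lambda G) (d_gt0 : (0 < d)%N) (n_gt1 : (1 < n)%N).
Hypotheses (eps_gt0 : 0 < eps) (eps_small : eps <= 1 / 20).
Hypothesis lambda_small : lambda <= eps ^+ 4 * d%:R.
Implicit Types (A B D P Q : {set 'I_n}).

Let dR : 0 < d%:R :> R. Proof. by rewrite ltr0n. Qed.
Let nR : 2 <= n%:R :> R. Proof. by rewrite (ler_nat R 2). Qed.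

Let eps2 : eps ^+ 2 <= 1 / 400.
Proof.
have -> : 1 / 400 = (1 / 20) ^+ 2 :> R by field.
by rewrite lerXn2r ?nnegrE // ?ltW //; lra.
Qed.

Let eps4 : eps ^+ 4 <= eps ^+ 2 / 400.
Proof.
have -> : eps ^+ 4 = eps ^+ 2 * eps ^+ 2 by ring.
apply: ler_wpM2l; first exact: sqr_ge0.
by have := eps2; lra.
Qed.

Let lambda_lt : lambda < d%:R.
Proof.
have := eps4; have := eps2 => e2 e4; apply: le_lt_trans lambda_small _.
rewrite gtr_pMl //; lra.
Qed.

Lemma ecount_setC A D : (ecount G A D + ecount G A (~: D) = d * #|A|)%N.
Proof.
rewrite /ecount -big_split /= mulnC -sum_nat_const; apply: eq_bigr => x _.
rewrite -(ndl.1 x) -sum1_card [RHS](bigID (mem D)) /=.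
rewrite big_mkcond [X in (_ + X)%N]big_mkcond.
rewrite [X in _ = (X + _)%N]big_mkcond [X in _ = (_ + X)%N]big_mkcond.
by congr (_ + _)%N; apply: eq_bigr => y _; rewrite !inE; case: (y \in D); case: (G x y).
Qed.

(** For a perfect matching, mixing between a vertex and its only neighbour
    forces [lambda >= 1 - 1 / n]. *)
Lemma degree_ge2 : (1 < d)%N.
Proof.
rewrite ltn_neqAle d_gt0 andbT; apply/eqP => d1.
have n0 : (0 < n)%N by exact: ltnW.
pose x := Ordinal n0.
have := expander_mixing [set x] [set y | G x y] ndl lambda_lt.
have -> : ecount G [set x] [set y | G x y] = d.
  rewrite /ecount big_set1 -(ndl.1 x) -sum1_card; apply: eq_bigr => y.
  by rewrite inE => ->.
rewrite (ndl.1 x) cards1 -d1 !mul1r => h.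
have : 1 - n%:R^-1 <= lambda.
  have := le_trans (ler_norm _) h; rewrite /= ?mulr1n; lra.
have : n%:R^-1 <= 1 / 2 :> R by rewrite div1r lef_pV2 ?posrE //; exact: lt_le_trans nR.
move: lambda_small; rewrite -d1; have := eps4; have := eps2; lra.
Qed.

Let d2 : 2 <= d%:R :> R. Proof. by rewrite (ler_nat R 2) degree_ge2. Qed.

Let p : R := (1 + eps) / d%:R.
Let q : R := 1 / d%:R.

Let q_gt0 : 0 < q. Proof. by rewrite /q divr_gt0. Qed.
Let q_le_p : q <= p. Proof. by rewrite /q /p ler_pM2r ?invr_gt0 // lerDl ltW. Qed.
Let p_le1 : p <= 1. Proof. rewrite /p ler_pdivrMr //; have := d2; have := eps_small; lra. Qed.
Let q_lt1 : q < 1. Proof. rewrite /q ltr_pdivrMr //; have := d2; lra. Qed.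

Lemma percolation_prob_range : 0 <= p <= 1.
Proof. by rewrite p_le1 (le_trans (ltW q_gt0) q_le_p). Qed.

Lemma closed_edges_factor (X : nat) :
  ((1 - p) / (1 - q)) ^+ X <= expR (- (eps * (X%:R / d%:R))).
Proof.
have -> : expR (- (eps * (X%:R / d%:R))) = expR (- (eps / d%:R)) ^+ X.
  by rewrite -expRM_natr; congr expR; ring.
have q1 : 0 < 1 - q by rewrite subr_gt0.
rewrite lerXn2r ?nnegrE ?expR_ge0 //.
  by rewrite divr_ge0 ?subr_ge0 // ltW.
apply: le_trans (expR_ge1Dx _).
rewrite ler_pdivrMr //.
have -> : p = q + eps / d%:R by rewrite /p /q; field; rewrite gt_eqF.
have : 0 <= eps / d%:R by rewrite divr_ge0 // ltW.
have := q_gt0; nra.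
Qed.

(** With [t = #|A|], mixing gives [e(A, D) <= eps d t / 6], and the exponent is at
    most [t ((eps - eps ^ 2 / 3) (1 + eps / 8) - eps (1 - eps / 6))], that is
    [- eps ^ 2 t (1 / 3 - 1 / 8 - 1 / 6)] up to a negative term of order
    [eps ^ 3]. *)
Lemma growth_factor (T0 : nat) A D : A \subset D ->
  (T0 <= #|A|)%N -> #|A|%:R <= eps * n%:R / 8 ->
  #|D|%:R <= (1 + eps / 8) * #|A|%:R ->
  (p / q) ^+ #|D| * ((1 - p) / (1 - q)) ^+ ecount G A (~: D) <=
    expR (- (eps ^+ 2 * T0%:R / 24)).
Proof.
move=> AD T0A At Dm; have [eg es] := (eps_gt0, eps_small).
have -> : p / q = 1 + eps by rewrite /p /q; field; rewrite gt_eqF.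
apply: (@le_trans _ _ (expR ((eps - eps ^+ 2 / 3) * #|D|%:R) *
   expR (- (eps * ((ecount G A (~: D))%:R / d%:R))))).
  apply: ler_pM.
  - by rewrite exprn_ge0 //; lra.
  - by rewrite exprn_ge0 // divr_ge0 // subr_ge0 // ltW.
  - rewrite expRM_natr lerXn2r ?nnegrE ?expR_ge0 //; first lra.
    by apply: ler1D_expR_third; lra.
  - exact: closed_edges_factor.
rewrite -expRD ler_expR.
have T0R : T0%:R <= #|A|%:R :> R by rewrite ler_nat.
have := congr1 (fun k : nat => k%:R : R) (ecount_setC A D).
rewrite natrD natrM => E.
have M := le_trans (ler_norm _) (expander_mixing A D ndl lambda_lt).
move: At Dm T0R E M.
set t := #|A|%:R; set m := #|D|%:R; set e1 := (ecount G A D)%:R.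
set e2 := (ecount G A (~: D))%:R; set dd := d%:R.
move=> At Dm T0R E M.
have t0 : 0 <= t by rewrite /t.
have m0 : 0 <= m by rewrite /m.
have mn : m / n%:R <= (1 + eps / 8) * (eps / 8).
  rewrite ler_pdivrMr; last by exact: lt_le_trans nR.
  apply: le_trans Dm _; rewrite -mulrA ler_pM2l; lra.
have h1 : dd * t * m / n%:R <= dd * t * ((1 + eps / 8) * (eps / 8)).
  by rewrite -mulrA; apply: ler_wpM2l => //; rewrite mulr_ge0 // ltW.
have h2 : lambda * ((t + m) / 2) <= dd * t * (eps ^+ 4 * (1 + eps / 16)).
  apply: (@le_trans _ _ (eps ^+ 4 * dd * ((t + m) / 2))).
    apply: ler_wpM2r; [lra|exact: lambda_small].
  have -> : dd * t * (eps ^+ 4 * (1 + eps / 16)) = eps ^+ 4 * dd * ((1 + eps / 16) * t) by ring.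
  apply: ler_wpM2l; last lra.
  by rewrite mulr_ge0 // ?exprn_ge0 // ltW.
have h3 : (1 + eps / 8) * (eps / 8) + eps ^+ 4 * (1 + eps / 16) <= eps / 6.
  have e3 : eps ^+ 4 <= eps / 100.
    by apply: le_trans eps4 _; nra.
  have : eps ^+ 4 * (1 + eps / 16) <= eps / 100 * 2.
    apply: ler_pM => //; first exact: exprn_ge0 (ltW _).
      lra.
    lra.
  nra.
have h4 : e1 <= dd * t * (eps / 6).
  have : dd * t * ((1 + eps / 8) * (eps / 8) + eps ^+ 4 * (1 + eps / 16)) <= dd * t * (eps / 6).
    by apply: ler_wpM2l => //; rewrite mulr_ge0 // ltW.
  rewrite mulrDr; lra.
have h5 : t * (1 - eps / 6) <= e2 / dd.
  rewrite ler_pdivlMr //; lra.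
have h6 : eps * (t * (1 - eps / 6)) <= eps * (e2 / dd) by rewrite ler_pM2l.
have h7 : (eps - eps ^+ 2 / 3) * m <= (eps - eps ^+ 2 / 3) * ((1 + eps / 8) * t).
  by apply: ler_wpM2l => //; nra.
have h8 : eps ^+ 2 * T0%:R <= eps ^+ 2 * t by apply: ler_wpM2l => //; exact: sqr_ge0.
have h9 : 0 <= eps ^+ 3 * t by rewrite mulr_ge0 // exprn_ge0 // ltW.
nra.
Qed.

(** Since [g n <= #|P|] and [g n <= #|Q|], the main term [d |P| |Q| / n] of the
    mixing lemma is at least [d g (|P| + |Q|) / 2], at least twice the error
    term. *)
Lemma gap_factor (g : R) P Q : 2 * eps ^+ 4 <= g -> 
  g * n%:R <= #|P|%:R -> g * n%:R <= #|Q|%:R ->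
  (1 - p) ^+ ecount G P Q <= expR (- (g ^+ 2 * n%:R / 2)).
Proof.
move=> ge hP hQ; have [eg es] := (eps_gt0, eps_small).
have := expander_mixing P Q ndl lambda_lt; rewrite ler_norml => /andP [M _].
have d0 : 0 < d%:R :> R by exact: dR.
have n0 : 0 < n%:R :> R by exact: lt_le_trans nR.
have l4 : lambda <= g / 2 * d%:R.
  apply: le_trans lambda_small _; rewrite ler_wpM2r //; lra.
have g0 : 0 < g by have : 0 < eps ^+ 4 by [exact: exprn_gt0]; lra.
apply: (@le_trans _ _ (expR (- q) ^+ ecount G P Q)).
  rewrite lerXn2r ?nnegrE ?expR_ge0 ?subr_ge0 //.
  by apply: le_trans (expR_ge1Dx _); have := q_le_p; lra.
rewrite -expRM_natr ler_expR mulNr lerN2 /q mul1r [leRHS]mulrC ler_pdivlMr //.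
move: M hP hQ; set a := #|P|%:R; set b := #|Q|%:R; set e1 := (ecount G P Q)%:R => M hP hQ.
pose c := a * b / n%:R.
have cE : d%:R * a * b / n%:R = d%:R * c by rewrite /c; ring.
have gn0 : 0 < g * n%:R by rewrite mulr_gt0.
have c1 : g * a <= c.
  rewrite /c ler_pdivlMr // mulrAC [a * b]mulrC; apply: ler_wpM2r => //; lra.
have c2 : g * b <= c.
  rewrite /c ler_pdivlMr // mulrAC; apply: ler_wpM2r => //; lra.
have c3 : g ^+ 2 * n%:R <= c.
  apply: le_trans c1; rewrite expr2 -mulrA; apply: ler_wpM2l => //; exact: ltW.
have h1 : lambda * ((a + b) / 2) <= d%:R * (c / 2).
  apply: (@le_trans _ _ (g / 2 * d%:R * ((a + b) / 2))).
    by apply: ler_wpM2r => //; lra.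
  have -> : g / 2 * d%:R * ((a + b) / 2) = d%:R * ((g * a + g * b) / 4) by field.
  by apply: ler_wpM2l; [exact: ltW|lra].
have h2 : d%:R * (g ^+ 2 * n%:R) <= d%:R * c by rewrite ler_pM2l.
rewrite cE in M; lra.
Qed.

(** The first term collects the slow balls over all centres and radii, the
    second the pairs of unmerged large layers. *)
Lemma failure_bound (T0 N L : nat) : N = (T0 + L)%N ->
  1 <= eps * n%:R / 8 -> T0%:R <= eps * n%:R / 16 ->
  n%:R < (1 + eps / 8) ^+ L ->
  1 - perc_prob G p [pred H | [forall K, largest_component (rel_of H) K ==>
       (diam (rel_of H) K <= (N + N).+1)%N]] <=
    (n * N)%:R * expR (- (eps ^+ 2 * T0%:R / 24)) +
    ((n * N) ^ 2)%:R * expR (- ((eps ^+ 2 / 128) ^+ 2 * n%:R / 2)).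
Proof.
move=> NE t11 T0t Lbig; have [eg es] := (eps_gt0, eps_small).
have hp := percolation_prob_range.
set t1 := eps * n%:R / 8.
pose bad1 A D := [&& (T0 <= #|A|)%N, #|A|%:R <= t1 & #|D|%:R <= (1 + eps / 8) * #|A|%:R].
pose big P := eps / 8 * t1 / 2 <= #|P|%:R.
pose J : finType := (('I_n * 'I_N) + (('I_n * 'I_N) * ('I_n * 'I_N)))%type.
pose ev1 (x : 'I_n * 'I_N) : pred {set {set 'I_n}} :=
  [pred H | bad1 (gball H x.1 x.2) (gball H x.1 x.2.+1)].
pose ev2 (x : ('I_n * 'I_N) * ('I_n * 'I_N)) : pred {set {set 'I_n}} := [pred H |
    let P := gball H x.1.1 x.1.2.+1 :\: gball H x.1.1 x.1.2 in
    let Q := gball H x.2.1 x.2.2.+1 :\: gball H x.2.1 x.2.2 in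
    [&& [disjoint gball H x.1.1 x.1.2.+1 & gball H x.2.1 x.2.2.+1],
        big P && big Q & [disjoint H & edge_cut G P Q]]].
pose ev (j : J) := match j with inl x => ev1 x | inr x => ev2 x end.
rewrite [perc_prob _ _ _](_ : _ = subset_prob (edges G) p [pred H | [forall K,
  largest_component (rel_of H) K ==> (diam (rel_of H) K <= (N + N).+1)%N]]) //.
rewrite subset_prob_compl opprB addrC subrK.
have e1 : 0 <= 1 + eps / 8 by lra.
apply: le_trans (subset_prob_union (J := J) (B := ev) hp _) _.
  move=> H HE nd; apply/not_existsP => noev; case/negP: nd.
  apply/forallP => K; apply/implyP => /andP [cK _].
  apply: (@diam_le _ H G big T0 N K) => //; first by rewrite NE leq_addr.
    move=> u; rewrite NE.
    apply: (@stable_or_large_layer R _ H u T0 L (eps / 8) t1); rewrite ?card_ord //.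
    - lra.
    - lra.
    - by rewrite /t1; lra.
    - rewrite -NE => r rN T0r rt; rewrite ltNge; apply/negP => h.
      by apply: (noev (inl (u, Ordinal rN))); apply/and3P.
  move=> u v r s rN sN /=; apply/negP => h.
  by apply: (noev (inr ((u, Ordinal rN), (v, Ordinal sN)))).
rewrite big_sumType /=; apply: lerD.
  apply: (@le_trans _ _ (\sum_(x : 'I_n * 'I_N) expR (- (eps ^+ 2 * T0%:R / 24)))).
    apply: ler_sum => x _; apply: (prob_gball_growth (q := q)) => //.
    by move=> A D AD /and3P [h1 h2 h3]; apply: growth_factor.
  by rewrite sumr_const card_prod !card_ord mulr_natl.
apply: (@le_trans _ _ (\sum_(x : ('I_n * 'I_N) * ('I_n * 'I_N))
    expR (- ((eps ^+ 2 / 128) ^+ 2 * n%:R / 2)))).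
  apply: ler_sum => x _; apply: (@prob_gap _ _ G p _ _ _ _ (fun P Q => big P && big Q)) => //.
  move=> P Q _ /andP [bP bQ]; apply: gap_factor.
  - by have := eps4; have := sqr_ge0 eps; lra.
  - by apply: le_trans bP; rewrite /t1; lra.
  - by apply: le_trans bQ; rewrite /t1; lra.
by rewrite sumr_const !card_prod !card_ord mulr_natl expnS expn1.
Qed.

End Expander.

(** * Asymptotics *)

(** Bounds [n] times each of the two terms of [failure_bound], the number of radii being
    at most [99 n / eps ^ 2]; the power [5] of [expRN_le_pow5] leaves one factor [1 / n]
    once the [n ^ 4] pairs of centres and radii are paid for. *)
Definition failure_const (R : realType) (eps : R) : R :=
  99 / eps ^+ 2 + (99 / eps ^+ 2) ^+ 2 * (120 * (2 / (eps ^+ 2 / 128) ^+ 2) ^+ 5).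

(** The choices are [T0 = 96 ln n / eps ^ 2] and [L = 16 ln n / eps], rounded up:
    [T0] turns the growth bound into [n ^ - 4], and [(1 + eps / 8) ^+ L] exceeds
    [n]. The lower bound on [n] ensures [ln n <= (eps ^+ 3 / 1600) n], so
    that [T0] is below half of [eps n / 8]. *)
Lemma large_diam_prob_le (R : realType) (n d : nat) (lambda eps : R) (G : sgraph 'I_n) :
  ndl_graph d lambda G -> (0 < d)%N ->
  0 < eps -> eps <= 1 / 20 -> lambda <= eps ^+ 4 * d%:R ->
  (4 <= n)%N -> 2 <= (eps ^+ 3 / 40 / 40) ^+ 2 * n%:R ->
  1 - perc_prob G ((1 + eps) / d%:R)
    (largest_diam_le (200 * (ln (1 / eps) * ln n%:R / eps ^+ 2))) <=
  failure_const eps / n%:R.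
Proof.
move=> ndl d0 e0 es lam n4 nlarge.
have n4R : 4 <= n%:R :> R by rewrite (ler_nat R 4).
have n0 : 0 < n%:R :> R by lra.
have e2 : 0 < eps ^+ 2 by exact: exprn_gt0.
pose l := ln n%:R : R; pose X := l / eps ^+ 2.
have l1 : 1 <= l by exact: ln_ge1.
have ln_n : l <= n%:R.
  by have := expR_ge1Dx l; rewrite /l lnK ?posrE //; lra.
have eX : l = eps ^+ 2 * X by rewrite /X mulrC divfK // gt_eqF.
have e21 : eps ^+ 2 <= 1 by rewrite expr_le1 //; lra.
have X1 : 1 <= X by rewrite /X ler_pdivlMr //; lra.
have Xn : X <= n%:R / eps ^+ 2 by rewrite /X ler_pM2r ?invr_gt0.
have le_over : l / eps <= X / 20.
  have -> : l / eps = eps * X by rewrite /X; field; rewrite gt_eqF.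
  by rewrite mulrC; nra.
have small_l : l <= eps ^+ 3 / 40 / 40 * n%:R.
  have a0 : 0 < eps ^+ 3 / 40 / 40 by rewrite !divr_gt0 // exprn_gt0.
  have h : l ^+ 2 <= (eps ^+ 3 / 40 / 40 * n%:R) ^+ 2.
    apply: (@le_trans _ _ (2 * n%:R)); first by apply: ln_sqr_le; lra.
    by rewrite exprMn [n%:R ^+ 2]expr2 mulrA ler_pM2r.
  have l_ge0 : 0 <= l by lra.
  move: h; rewrite ler_pXn2r ?nnegrE //; exact: mulr_ge0 (ltW a0) (ltW n0).
pose T0 := (Num.truncn (96 * X)).+1.
pose L := (Num.truncn (16 * (l / eps))).+1.
have trP (x : R) : 0 <= x -> x < (Num.truncn x).+1%:R /\ (Num.truncn x).+1%:R <= x + 1.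
  by move=> x0; have /andP [h1 h2] := truncn_itv x0; split=> //; rewrite -natr1; lra.
have [T0a T0b] : 96 * X < T0%:R /\ T0%:R <= 96 * X + 1 by apply: trP; lra.
have [La Lb] : 16 * (l / eps) < L%:R /\ L%:R <= 16 * (l / eps) + 1.
  by apply: trP; rewrite mulr_ge0 // divr_ge0 //; lra.
pose N := (T0 + L)%N.
have NX : N%:R <= 99 * X by rewrite /N natrD; lra.
have Nn : N%:R <= 99 * (n%:R / eps ^+ 2) by apply: le_trans NX _; rewrite ler_pM2l.
have lX : X <= ln (1 / eps) * l / eps ^+ 2.
  rewrite /X ler_pM2r ?invr_gt0 // ler_peMl //; first lra.
  apply: ln_ge1; rewrite ler_pdivlMr //; lra.
have T0n : T0%:R <= eps * n%:R / 16.
  apply: (@le_trans _ _ (97 * X)); first lra.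
  rewrite -(ler_pM2l e2).
  have -> : eps ^+ 2 * (97 * X) = 97 * l by rewrite eX; ring.
  have -> : eps ^+ 2 * (eps * n%:R / 16) = 100 * (eps ^+ 3 / 40 / 40 * n%:R) by field.
  lra.
have n_gt1 : (1 < n)%N by exact: leq_trans n4.
have Lbig : n%:R < (1 + eps / 8) ^+ L.
  apply: (@lt_le_trans _ _ (expR (eps / 8 / 2) ^+ L)).
    rewrite -expRM_natr -[X in X < _](lnK (x := n%:R)) ?posrE // ltr_expR -/l.
    have : eps / 16 * (16 * (l / eps)) < eps / 16 * L%:R by rewrite ltr_pM2l //; lra.
    have -> : eps / 16 * (16 * (l / eps)) = l by field; rewrite gt_eqF.
    lra.
  rewrite lerXn2r ?nnegrE ?expR_ge0 //; first lra.
  by apply: expR_half_le; lra.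
have t1 : 1 <= eps * n%:R / 8 by move: T0n T0a X1; clear; lra.
have hp := percolation_prob_range ndl d0 n_gt1 e0 es lam.
apply: le_trans (le_trans _ (failure_bound ndl d0 n_gt1 e0 es lam
   (erefl : N = (T0 + L)%N) t1 T0n Lbig)) _.
  rewrite lerD2l lerN2; apply: subset_prob_mono => // H HE /forallP h.
  apply/forallP => K; apply/implyP => lK.
  have := h K; rewrite lK /= -(ler_nat R) => /le_trans; apply.
  by rewrite -natr1 natrD -/l; move: NX X1 lX; clear; lra.
rewrite /failure_const mulrDl; apply: lerD.
  apply: (@le_trans _ _ ((n%:R * (99 * (n%:R / eps ^+ 2))) * (n%:R ^+ 4)^-1)).
    apply: ler_pM => //; rewrite ?expR_ge0 //.
      by rewrite natrM ler_pM2l.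
    have -> : (n%:R ^+ 4)^-1 = expR (- (l * 4)).
      by rewrite expRN expRM_natr /l lnK ?posrE.
    rewrite ler_expR lerN2.
    have : eps ^+ 2 * (96 * X) <= eps ^+ 2 * T0%:R by rewrite ler_pM2l // ltW.
    have -> : eps ^+ 2 * (96 * X) = 96 * l by rewrite eX; ring.
    by clear; lra.
  have -> : n%:R * (99 * (n%:R / eps ^+ 2)) / n%:R ^+ 4 = 99 / eps ^+ 2 / n%:R * n%:R^-1.
    by field; rewrite !gt_eqF.
  apply: ler_piMr; first by rewrite !divr_ge0 // ltW.
  by rewrite invf_le1 // (le_trans _ n4R) // ler1n.
set g := eps ^+ 2 / 128.
have g0 : 0 < g by rewrite /g divr_gt0.
apply: (@le_trans _ _ ((n%:R * (99 * (n%:R / eps ^+ 2))) ^+ 2 * (120 / (g ^+ 2 * n%:R / 2) ^+ 5))).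
  apply: ler_pM => //; rewrite ?expR_ge0 //.
    have bn0 : 0 <= n%:R * (99 * (n%:R / eps ^+ 2)) by rewrite !mulr_ge0 ?invr_ge0 // ltW.
    by rewrite natrX natrM ler_pXn2r ?nnegrE // ?mulr_ge0 // ler_pM2l.
  by apply: expRN_le_pow5; rewrite divr_gt0 // mulr_gt0 // exprn_gt0.
rewrite le_eqVlt; apply/orP; left; apply/eqP.
by field; rewrite !gt_eqF.
Qed.

Local Open Scope classical_set_scope.

Theorem theorem4 (R : realType) :
  exists eps0 : R, 0 < eps0 /\
  exists C : R, 0 < C /\
  forall eps delta : R, 0 < eps -> eps <= eps0 ->
    0 < delta -> delta <= eps ^+ 4 ->
  forall (n d : nat -> nat) (lambda : nat -> R)
    (G : forall k : nat, sgraph 'I_(n k)),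
    n k @[k --> \oo] --> \oo ->
    (forall k : nat, (0 < d k)%N) ->
    (forall k : nat, ndl_graph (d k) (lambda k) (G k)) ->
    (forall k : nat, lambda k / (d k)%:R <= delta) ->
  perc_prob (G k) ((1 + eps) / (d k)%:R)
    (largest_diam_le (C * (ln (1 / eps) * ln (n k)%:R / eps ^+ 2)))
    @[k --> \oo] --> (1 : R).
Proof.
exists (1 / 20); split; first lra.
exists 200; split; first lra.
move=> eps delta e0 es _ de n d lambda G nk d0 ndl lam.
have lamd k : lambda k <= eps ^+ 4 * (d k)%:R.
  rewrite -ler_pdivrMr ?ltr0n //; exact: le_trans (lam k) de.
apply/cvgrPdist_le => e e_gt0.
pose b : R := Num.max 4 (Num.max (2 / (eps ^+ 3 / 40 / 40) ^+ 2) (failure_const eps / e)).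
have [M _ nM] := (cvgnyPge _).1 nk (Num.truncn b).+1.
exists M => // k /nM /= nk_ge.
have bn : b <= (n k)%:R.
  by apply: le_trans (ltW (truncnS_gt b)) _; rewrite ler_nat.
move: bn; rewrite !ge_max => /and3P [n4 n2 n3].
have n4' : (4 <= n k)%N by rewrite -(ler_nat R).
have n_gt0 : 0 < (n k)%:R :> R by lra.
have e3 : 0 < (eps ^+ 3 / 40 / 40) ^+ 2 by rewrite exprn_gt0 // !divr_gt0 // exprn_gt0.
rewrite ler_pdivrMr // mulrC in n2.
have bound := large_diam_prob_le (ndl k) (d0 k) e0 es (lamd k) n4' n2.
have hp := percolation_prob_range (ndl k) (d0 k) (leq_trans (isT : (1 < 4)%N) n4') e0 es (lamd k).
rewrite ger0_norm; last by rewrite subr_ge0; exact: subset_prob_le1.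
apply: le_trans bound _; rewrite ler_pdivrMr // mulrC -ler_pdivrMr //.
Qed.
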